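(* Let $p\in\Delta_{m-1}$ and $\theta\ge0$. For $(u,v,X)\in\mathbb R^m\times\mathbb R^{N_T}\times\mathbb R^n$ let $$f_3(u,v,X)=-\sum_{j=1}^m(p_j+u_j)\langle S_{T+1}(j),X_T(j^-)\rangle+\iota_{\mathcal X(v)}(X)+\tfrac12\theta\|u\|_2^2+\iota_{[0,\infty)^m}(p+u)+\iota_{(-\infty,0]^m}(u),$$ let $\psi_3:\mathbb R^m\times\mathbb R^{N_T}\to\overline{\mathbb R}$ be its dual function, and let $\varphi(X)=-\sum_{j=1}^mp_j\langle S_{T+1}(j),X_T(j^-)\rangle+\iota_{\mathcal X(0)}(X)$. Then, regardless of whether $\theta=0$ or $\theta>0$, $$\sup_{(y,z)\in\mathbb R^m\times\mathbb R^{N_T}}\psi_3(y,z)=\min_{X\in\mathbb R^n}\varphi(X).$$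
   Context: Scenario tree. Let $T,k\ge 1$ be integers and consider a finite rooted tree with levels $0,1,\dots,T+1$ (the history tree of a finitely supported discrete-time environment process), in which every node at a level $\le T$ has at least one child. For $0\le t\le T$, $I_t$ is the set of nodes at level $t$ ($I_0$ consists of the root), $n_t=|I_t|$, $N_T=\sum_{t=0}^T n_t$, $n=(k+1)N_T$. The terminal nodes (level $T+1$) are labeled $1,\dots,m$. For a node $i$, $i^-$ is its parent and $i^+$ its set of children. The terminal nodes are partitioned into original scenarios $I$ and added critical scenarios $\tilde I$ (all nodes at levels $\le T$ belong to the original tree). Market. Asset prices are $S_t(i)=(S_t^0,S_t^1(i),\dots,S_t^k(i))\in(0,\infty)^{k+1}$ for each node $i$ at level $t$; asset $0$ is risk-free (its price depends only on $t$). For $j\in\tilde I$ and $1\le i\le k$, $S^i_{T+1}(j)=\kappa_j^iS^i_T(j^-)$ with $\kappa_j^i>0$. The original market is arbitrage-free (no self-financing strategy with zero initial wealth has terminal wealth that is nonnegative a.s. and positive with positive probability). The claim is $G_0>0$ and $G_t(i)<0$ for $i\in I_t$, $1\le t\le T$. Probabilities. $\Delta_{m-1}=\{p\in\mathbb R^m_+:\sum_jp_j=1\}$; $p_j$ is the probability of terminal node $j$, with $p_j=0$ for $j\in\tilde I$. Strategies and perturbed feasible sets. $X\in\mathbb R^n$ is a family $X_t(i)\in\mathbb R^{k+1}$, $i\in I_t$, $0\le t\le T$. A claim perturbation $v\in\mathbb R^{N_T}$ has one component $v_t(i)$ per node $i\in I_t$, $0\le t\le T$. $\mathcal X(v)$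 is the set of all $X$ with $X_t(i)\ge0$ componentwise for all $i\in I_t$, $0\le t\le T$; $\langle S_0,X_0\rangle\le G_0+v_0$; and $\langle S_t(i),X_t(i)-X_{t-1}(i^-)\rangle\le G_t(i)+v_t(i)$ for all $i\in I_t$, $1\le t\le T$. The unperturbed problem is assumed feasible: $\mathcal X(0)\neq\emptyset$. $\iota_C$ is the indicator function ($0$ on $C$, $+\infty$ off $C$). The dual function associated with $f:\mathbb R^m\times\mathbb R^{N_T}\times\mathbb R^n\to\overline{\mathbb R}$ is $\psi(y,z)=\inf_{(u,v,X)}\{f(u,v,X)-\langle y,u\rangle-\langle z,v\rangle\}$. *)

(* Defs.v *)
From HB Require Import structures.
From mathcomp Require Import all_boot all_order all_algebra.
From mathcomp Require Import all_classical all_reals ereal.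
Set Implicit Arguments.
Unset Strict Implicit.
Unset Printing Implicit Defensive.
Import Order.TTheory GRing.Theory Num.Theory.
Local Open Scope classical_set_scope.
Local Open Scope ring_scope.

(* Euclidean spaces are coordinate spaces {ffun I -> R} over a finite index
   type I, with the pointwise vector-space structure. *)
Definition dot (R : realType) (I : finType) (x y : {ffun I -> R}) : R :=
  \sum_i x i * y i.

Definition nonneg_orthant (R : realType) (I : finType) : set {ffun I -> R} :=
  [set x | forall i, 0 <= x i].

Definition nonpos_orthant (R : realType) (I : finType) : set {ffun I -> R} :=
  [set x | forall i, x i <= 0].

Definition simplex (R : realType) (I : finType) : set {ffun I -> R} :=
  [set p | nonneg_orthant p /\ \sum_i p i = 1].

Definition cvx_indicator (R : realType) (E : Type) (C : set E) (x : E) : \bar R :=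
  if x \in C then 0%E else +oo%E.

Definition dual_function (R : realType) (I J : finType) (E : Type)
    (f : {ffun I -> R} -> {ffun J -> R} -> E -> \bar R)
    (y : {ffun I -> R}) (z : {ffun J -> R}) : \bar R :=
  ereal_inf [set (f w.1.1 w.1.2 w.2 - (dot y w.1.1)%:E - (dot z w.1.2)%:E)%E
            | w in [set: {ffun I -> R} * {ffun J -> R} * E]].

(* The nodes at levels 0, ..., T form the type [node] (so #|node| = N_T); the
   terminal nodes, at level T+1, are kept apart and labeled by 'I_m.  The
   parent of j : 'I_m is [tparent j]; [parent root_node] is a junk value.
   The terminal nodes outside [original] are the added critical scenarios.
   A node of level <= T is in the original tree iff an original terminal node
   descends from it; given [has_child], this holds for all nodes of
   level <= T iff it holds at level T, which is [has_original_child]. *)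
Record scenario_tree (T m : nat) := ScenarioTree {
  node :> finType;
  level : node -> nat;
  root_node : node;
  parent : node -> node;
  tparent : 'I_m -> node;
  original : {set 'I_m};
  level_le : forall i, (level i <= T)%N;
  level_eq0 : forall i, (level i == 0%N) = (i == root_node);
  level_parent : forall i, i != root_node -> level i = (level (parent i)).+1;
  level_tparent : forall j, level (tparent j) = T;
  has_child : forall i, (level i < T)%N ->
    exists2 i', i' != root_node & parent i' = i;
  has_original_child : forall i, level i = T ->
    exists2 j, j \in original & tparent j = i
}.

(* Asset [ord0] is the risk-free one, the risky assets are [lift ord0 a] for
   a : 'I_k. *)
Record market (R : realType) (T m k : nat) (tr : scenario_tree T m) := Market {
  price : tr -> {ffun 'I_k.+1 -> R};
  tprice : 'I_m -> {ffun 'I_k.+1 -> R};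
  kappa : 'I_m -> 'I_k -> R;
  price_gt0 : forall i a, 0 < price i a;
  tprice_gt0 : forall j a, 0 < tprice j a;
  price_riskfree : forall i i', level i = level i' ->
    price i ord0 = price i' ord0;
  tprice_riskfree : forall j j', tprice j ord0 = tprice j' ord0;
  kappa_gt0 : forall j a, j \notin original tr -> 0 < kappa j a;
  tprice_critical : forall j a, j \notin original tr ->
    tprice j (lift ord0 a) = kappa j a * price (tparent tr j) (lift ord0 a)
}.

Definition strategy (R : realType) (T m k : nat) (tr : scenario_tree T m) : Type :=
  {ffun tr -> {ffun 'I_k.+1 -> R}}.

Section Market.
Variables (R : realType) (T m k : nat) (tr : scenario_tree T m).
Variable M : market R k tr.
Implicit Types (X : strategy R k tr) (p u : {ffun 'I_m -> R}).
Implicit Types (G v : {ffun tr -> R}).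

Definition terminal_wealth X (j : 'I_m) : R :=
  dot (tprice M j) (X (tparent tr j)).

Definition self_financing X : Prop :=
  forall i, i != root_node tr -> dot (price M i) (X i - X (parent i)) = 0.

(* Short positions are allowed here.  "Almost surely" and "with positive
   probability" refer to the probabilities p of the terminal nodes, which
   vanish on the critical scenarios. *)
Definition arbitrage_free p : Prop :=
  ~ exists X,
      [/\ self_financing X,
          dot (price M (root_node tr)) (X (root_node tr)) = 0,
          forall j, 0 < p j -> 0 <= terminal_wealth X j
        & exists2 j, 0 < p j & 0 < terminal_wealth X j].

Definition feasible G v : set (strategy R k tr) :=
  [set X | [/\ forall i, nonneg_orthant (X i),
               dot (price M (root_node tr)) (X (root_node tr)) <= G (root_node tr) + v (root_node tr)
             & forall i, i != root_node tr ->
                 dot (price M i) (X i - X (parent i)) <= G i + v i]].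

Definition f3 G p (theta : R) u v X : \bar R :=
  ((- \sum_j (p j + u j) * terminal_wealth X j)%:E
   + cvx_indicator R (feasible G v) X
   + (2^-1 * theta * \sum_j u j ^+ 2)%:E
   + cvx_indicator R (@nonneg_orthant R 'I_m) (p + u)%R
   + cvx_indicator R (@nonpos_orthant R 'I_m) u)%E.

Definition psi3 G p (theta : R) : {ffun 'I_m -> R} -> {ffun tr -> R} -> \bar R :=
  dual_function (f3 G p theta).

Definition phi G p X : \bar R :=
  ((- \sum_j p j * terminal_wealth X j)%:E
   + cvx_indicator R (feasible G 0%R) X)%E.

End Market.

(* Main.v *)
(* Feasible strategies are nonnegative and prices are positive, so terminal
   wealth is nonnegative and at y = 0 the infimum over u <= 0 in psi3 is
   attained at u = 0, whatever theta is.  What remains is the linear program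
   "maximize expected terminal wealth under the budget constraints" and its
   dual.  Strong duality for it, with attainment on both sides, follows from
   Farkas' lemma applied to the primal and dual constraints taken together
   with the reversed weak duality inequality. *)
Require Import Defs.
From HB Require Import structures.
From mathcomp Require Import all_boot all_order all_algebra.
From mathcomp Require Import all_classical all_reals ereal.
From mathcomp Require Import ring lra.
Set Implicit Arguments.
Unset Strict Implicit.
Unset Printing Implicit Defensive.
Import Order.TTheory GRing.Theory Num.Theory.
Local Open Scope classical_set_scope.
Local Open Scope ring_scope.

(** * Farkas' lemma and linear programming duality *)

Section LinearProgramming.
Variable R : realType.

(* Bartl's induction: if dropping the functional [alpha i] breaks the
   hypothesis at a point [w], then [alpha i w > 0], and projecting along [w]
   onto the kernel of [alpha i] reduces to the remaining functionals. *)
Lemma farkas_cone (I J : finType) (s : seq I) (alpha : I -> J -> R) (g : J -> R) :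
  uniq s ->
  (forall x : J -> R, (forall i, i \in s -> \sum_j alpha i j * x j <= 0) ->
     \sum_j g j * x j <= 0) ->
  exists2 u : I -> R, (forall i, 0 <= u i)
    & forall j, g j = \sum_(i <- s) u i * alpha i j.
Proof.
elim: s alpha g => [|i s IH] alpha g /=.
  move=> _ Hg; exists (fun=> 0) => // j; rewrite big_nil.
  (* With no functional left, testing the hypothesis at [g] itself gives a nonpositive sum of
     squares, so [g] vanishes. *)
  have /(_ g) := Hg; rewrite (_ : \sum_j _ = \sum_j g j ^+ 2) => [H|];
    last by apply: eq_bigr => j' _; rewrite expr2.
  apply/eqP; rewrite -sqrf_eq0 eq_le sqr_ge0 andbT.
  apply: le_trans (H _) => [|//].
  by rewrite (bigD1 j) //= lerDl sumr_ge0 // => j' _; rewrite sqr_ge0.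
case/andP=> nis us Hg.
have [Hs|/existsNP[w0 /not_implyP[w0s /negP]]] := pselect (forall x : J -> R,
  (forall i, i \in s -> \sum_j alpha i j * x j <= 0) -> \sum_j g j * x j <= 0).
  have [u u0 Eu] := IH alpha g us Hs.
  exists (fun i' => if i' == i then 0 else u i') => [i'|j]; first by case: ifP.
  rewrite big_cons eqxx mul0r add0r Eu !big_seq; apply: eq_bigr => i' i's.
  by case: eqP => // Ei; rewrite -Ei i's in nis.
rewrite -ltNge => gw0.
have aw0 : 0 < \sum_j alpha i j * w0 j.
  rewrite ltNge; apply/negP => aw0; move: gw0; rewrite ltNge Hg //.
  by move=> i'; rewrite inE => /orP[/eqP->|/w0s].
set c := \sum_j alpha i j * w0 j in aw0.
pose w j := w0 j / c.
have dotw (h : J -> R) : \sum_j h j * w j = (\sum_j h j * w0 j) / c.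
  by rewrite mulr_suml; apply: eq_bigr => j _; rewrite /w mulrA.
have aw : \sum_j alpha i j * w j = 1 by rewrite dotw divff // gt_eqF.
have ws i' : i' \in s -> \sum_j alpha i' j * w j <= 0.
  by move=> /w0s; rewrite dotw => H; rewrite pmulr_lle0 // invr_gt0.
have gw : 0 <= \sum_j g j * w j by rewrite dotw ltW // divr_gt0.
(* Since [alpha i] is 1 at [w], [proj h] is [h] composed with the projection along [w] onto the
   kernel of [alpha i]. *)
pose proj (h : J -> R) j := h j - (\sum_j h j * w j) * alpha i j.
have proj_dot h x : \sum_j proj h j * x j =
    \sum_j h j * (x j - (\sum_j alpha i j * x j) * w j).
  under eq_bigr do rewrite /proj mulrBl -mulrA.
  under [RHS]eq_bigr do rewrite mulrBr mulrCA.
  by rewrite !sumrB -!mulr_sumr mulrC.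
have [|u u0 Eu] := IH (fun i' => proj (alpha i')) (proj g) us.
  move=> x Hx; rewrite proj_dot; apply: Hg => i'.
  rewrite inE => /orP[/eqP->|/Hx]; last by rewrite proj_dot.
  under eq_bigr do rewrite mulrBr mulrCA.
  by rewrite sumrB -mulr_sumr aw mulr1 subrr.
(* This is the coefficient of [alpha i] once [proj] is expanded in [Eu]; its sign follows from [gw]
   and [ws]. *)
pose c' := \sum_j g j * w j - \sum_(i' <- s) u i' * \sum_j alpha i' j * w j.
exists (fun i' => if i' == i then c' else u i') => [i'|j].
  case: ifP => // _; rewrite /c' subr_ge0; apply: le_trans gw.
  by rewrite big_seq sumr_le0 // => k /ws; apply: mulr_ge0_le0.
rewrite big_cons eqxx.
rewrite [X in _ = _ + X](_ : _ = \sum_(i' <- s) u i' * alpha i' j); last first.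
  rewrite !big_seq; apply: eq_bigr => i' i's.
  by case: eqP => // Ei; rewrite -Ei i's in nis.
have := Eu j; rewrite /proj; under [in RHS]eq_bigr do rewrite mulrBr mulrA.
rewrite sumrB -mulr_suml => /eqP; rewrite subr_eq => /eqP ->.
by rewrite /c' mulrBl; ring.
Qed.

(** Apply [farkas_cone] to the negated coordinates and negated columns of [A], with target [- b]:
    the multipliers of the columns form [x], those of the coordinates are the slacks. *)
Lemma farkas (I J : finType) (A : I -> J -> R) (b : I -> R) :
  (forall y : I -> R, (forall i, 0 <= y i) ->
     (forall j, 0 <= \sum_i A i j * y i) -> 0 <= \sum_i b i * y i) ->
  exists2 x : J -> R, (forall j, 0 <= x j) & forall i, \sum_j A i j * x j <= b i.
Proof.
move=> H.
pose alpha (e : I + J) i : R := match e with inl i' => - (i == i')%:R | inr j => - A i j end.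
have [||u u0 Eu] := @farkas_cone _ _ (index_enum (I + J)%type) alpha (fun i => - b i).
- exact: index_enum_uniq.
- move=> y Hy; under eq_bigr do rewrite mulNr.
  rewrite sumrN oppr_le0; apply: H => [i|j].
    have := Hy (inl i) (mem_index_enum _); rewrite (bigD1 i) //= eqxx big1 => [|i' /negPf->].
      by rewrite mulN1r addr0 oppr_le0.
    by rewrite oppr0 mul0r.
  have := Hy (inr j) (mem_index_enum _) => /=; under eq_bigr do rewrite mulNr.
  by rewrite sumrN oppr_le0.
exists (fun j => u (inr j)) => // i; rewrite -lerN2 Eu big_sumType /= -sumrN.
under [X in _ + X]eq_bigr do rewrite mulrN mulrC.
rewrite gerDr sumr_le0 // => i' _.
by rewrite mulrN oppr_le0 mulr_ge0.
Qed.

Lemma lp_weak_duality (I J : finType) (A : I -> J -> R) (b : I -> R) (c : J -> R)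
    (x : J -> R) (y : I -> R) :
  (forall j, 0 <= x j) -> (forall i, \sum_j A i j * x j <= b i) ->
  (forall i, 0 <= y i) -> (forall j, c j <= \sum_i A i j * y i) ->
  \sum_j c j * x j <= \sum_i b i * y i.
Proof.
move=> x0 Ax y0 Ay.
apply: (@le_trans _ _ (\sum_j \sum_i A i j * y i * x j)).
  by apply: ler_sum => j _; rewrite -mulr_suml ler_wpM2r.
rewrite exchange_big; apply: ler_sum => i _.
by under eq_bigr do rewrite mulrAC; rewrite -mulr_suml ler_wpM2r.
Qed.

Lemma lp_strong_duality (I J : finType) (A : I -> J -> R) (b : I -> R) (c : J -> R)
    (x0 : J -> R) (y0 : I -> R) :
  (forall j, 0 <= x0 j) -> (forall i, \sum_j A i j * x0 j <= b i) ->
  (forall i, 0 <= y0 i) -> (forall j, c j <= \sum_i A i j * y0 i) ->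
  exists x : J -> R, exists y : I -> R,
    [/\ forall j, 0 <= x j, forall i, \sum_j A i j * x j <= b i,
        forall i, 0 <= y i, forall j, c j <= \sum_i A i j * y i
      & \sum_j c j * x j = \sum_i b i * y i].
Proof.
move=> x0_ge0 Ax0 y0_ge0 Ay0.
(* The unknown is the pair (x, y); the rows encode A x <= b, c <= A^T y and b.y <= c.x. *)
pose B (e : I + J + unit) (d : J + I) : R := match e, d with
  | inl (inl i), inl j => A i j
  | inl (inr j), inr i => - A i j
  | inr _, inl j => - c j
  | inr _, inr i => b i
  | _, _ => 0 end.
pose r (e : I + J + unit) : R := match e with
  | inl (inl i) => b i | inl (inr j) => - c j | inr _ => 0 end.
have sumB (d : I + J + unit -> R) : \sum_e d e =
    \sum_i d (inl (inl i)) + \sum_j d (inl (inr j)) + d (inr tt).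
  by rewrite !big_sumType /= [X in _ + X](big_pred1 tt) // => -[].
have [w w0 Hw|z z0 Hz] := @farkas _ _ B r.
  pose u i := w (inl (inl i)); pose v j := w (inl (inr j)); pose t := w (inr tt).
  have t0 : 0 <= t by apply: w0.
  have Hu j : c j * t <= \sum_i A i j * u i.
    have := Hw (inl j); rewrite sumB /= [X in _ + X + _]big1 => [|? _].
      by rewrite addr0 mulNr subr_ge0.
    by rewrite mul0r.
  have Hv i : \sum_j A i j * v j <= b i * t.
    have := Hw (inr i); rewrite sumB /= big1 => [|? _]; last by rewrite mul0r.
    under eq_bigr do rewrite mulNr.
    by rewrite sumrN add0r addrC subr_ge0.
  rewrite sumB /= mul0r addr0; under [X in _ + X]eq_bigr do rewrite mulNr.
  rewrite sumrN subr_ge0 -/u -/v.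
  (* If t = 0, then [v] and [u] are recession directions of the primal and the dual; pairing them
     with [y0] and [x0] gives c.v <= 0 <= b.u. If t > 0, weak duality for the data scaled by t
     suffices. *)
  have [tz|tn] := eqVneq t 0.
    apply: (@le_trans _ _ 0).
      have := @lp_weak_duality _ _ A (fun=> 0) c v y0.
      rewrite [X in _ <= X]big1 => [|? _]; last by rewrite mul0r.
      by apply=> // [j|i]; [apply: w0|have := Hv i; rewrite tz mulr0].
    have := @lp_weak_duality _ _ A b (fun=> 0) x0 u.
    rewrite [X in X <= _]big1 => [|? _]; last by rewrite mul0r.
    by apply=> // [i|j]; [apply: w0|have := Hu j; rewrite tz mulr0].
  have tp : 0 < t by rewrite lt_neqAle eq_sym tn.
  have := @lp_weak_duality _ _ A (fun i => b i * t) (fun j => c j * t) v u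
    (fun j => w0 _) Hv (fun i => w0 _) Hu.
  rewrite /=; under eq_bigr do rewrite mulrAC; rewrite -mulr_suml.
  under [X in _ <= X]eq_bigr do rewrite mulrAC; rewrite -mulr_suml.
  by rewrite ler_pM2r.
pose x j := z (inl j); pose y i := z (inr i).
have Hx i : \sum_j A i j * x j <= b i.
  have := Hz (inl (inl i)); rewrite big_sumType /= [X in _ + X]big1 ?addr0 //.
  by move=> ? _; rewrite mul0r.
have Hy j : c j <= \sum_i A i j * y i.
  have := Hz (inl (inr j)); rewrite big_sumType /= [X in X + _]big1 => [|? _].
    under eq_bigr do rewrite mulNr.
    by rewrite sumrN add0r lerN2.
  by rewrite mul0r.
exists x, y; split=> //; try by move=> ?; apply: z0.
apply/eqP; rewrite eq_le (lp_weak_duality _ Hx _ Hy) //=; try by move=> ?; apply: z0.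
have := Hz (inr tt); rewrite big_sumType /=.
under eq_bigr do rewrite mulNr.
by rewrite sumrN addrC subr_le0.
Qed.

End LinearProgramming.

(** * The scenario tree problem in linear programming form *)

Section ScenarioLP.
Variables (R : realType) (T m k : nat) (tr : scenario_tree T m).
Variable M : market R k tr.

(** The test on the root discards the junk value of [parent] there. *)
Definition budget_coef (i : tr) (e : tr * 'I_k.+1) : R :=
  price M i e.2 * ((e.1 == i)%:R - ((i != root_node tr) && (e.1 == parent i))%:R).

(** Coefficients of expected terminal wealth; the sum is empty below level T by [level_tparent]. *)
Definition wealth_coef (p : {ffun 'I_m -> R}) (e : tr * 'I_k.+1) : R :=
  \sum_(j | tparent tr j == e.1) p j * tprice M j e.2.

Lemma budget_coefE (X : strategy R k tr) i :
  \sum_e budget_coef i e * X e.1 e.2 =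
  dot (price M i) (if i == root_node tr then X i else X i - X (parent i)).
Proof.
have sum_at (i0 : tr) a : \sum_i' (i' == i0)%:R * X i' a = X i0 a.
  by rewrite (bigD1 i0) //= eqxx mul1r big1 ?addr0 // => i' /negPf->; rewrite mul0r.
rewrite -(pair_bigA _ (fun i' a => budget_coef i (i', a) * X i' a)) exchange_big.
apply: eq_bigr => a _; rewrite /budget_coef /=.
under eq_bigr do rewrite -mulrA mulrBl.
rewrite -mulr_sumr sumrB sum_at; congr (_ * _).
case: eqP => _ /=; last by rewrite sum_at !ffunE.
by rewrite big1 ?subr0 // => ? _; rewrite mul0r.
Qed.

Lemma wealth_coefE p (X : strategy R k tr) :
  \sum_e wealth_coef p e * X e.1 e.2 = \sum_j p j * terminal_wealth M X j.
Proof.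
rewrite -(pair_bigA _ (fun i a => wealth_coef p (i, a) * X i a)) /=.
rewrite [RHS](partition_big (tparent tr) xpredT) //=; apply: eq_bigr => i _.
under eq_bigr do rewrite /wealth_coef /= mulr_suml.
rewrite exchange_big; apply: eq_bigr => j /eqP <-.
by rewrite mulr_sumr; apply: eq_bigr => a _; rewrite mulrA.
Qed.

Lemma feasibleE G v (X : strategy R k tr) : feasible M G v X <->
  (forall e : tr * 'I_k.+1, 0 <= X e.1 e.2) /\
  (forall i, \sum_e budget_coef i e * X e.1 e.2 <= G i + v i).
Proof.
split=> [[X0 Hr Hi]|[X0 HX]].
  split=> [e|i]; first exact: X0.
  by rewrite budget_coefE; case: eqVneq => [->|/Hi].
split=> [i a||i /negPf ir]; first exact: (X0 (i, a)).
  by have := HX (root_node tr); rewrite budget_coefE eqxx.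
by have := HX i; rewrite budget_coefE ir.
Qed.

Lemma terminal_wealth_ge0 (X : strategy R k tr) j :
  (forall i, nonneg_orthant (X i)) -> 0 <= terminal_wealth M X j.
Proof.
move=> X0; apply: sumr_ge0 => a _; apply: mulr_ge0; last exact: X0.
exact/ltW/tprice_gt0.
Qed.

(* The multipliers decrease geometrically in the level, fast enough that the
   price at a node pays for all later prices. *)
Lemma dual_feasible (p : {ffun 'I_m -> R}) : (forall j, 0 <= p j) ->
  exists2 y : tr -> R, (forall i, 0 <= y i)
    & forall e, wealth_coef p e <= \sum_i budget_coef i e * y i.
Proof.
move=> p0.
have S0 i a : 0 <= price M i a by apply/ltW/price_gt0.
have pS0 j a : 0 <= p j * tprice M j a by apply: mulr_ge0 => //; apply/ltW/tprice_gt0.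
pose s a : R := \sum_i price M i a + \sum_j p j * tprice M j a.
have s0 a : 0 <= s a by rewrite addr_ge0 ?sumr_ge0.
(* Large enough that K >= 1 and, by [sK], K times any price of asset [a] dominates [s a]. *)
pose K : R := 1 + \sum_(e : tr * 'I_k.+1) s e.2 / price M e.1 e.2.
have q0 (e : tr * 'I_k.+1) : 0 <= s e.2 / price M e.1 e.2 by apply: divr_ge0.
have K1 : 1 <= K by rewrite lerDl sumr_ge0.
have K0 : 0 <= K by apply: le_trans K1.
have sK i a : s a <= K * price M i a.
  rewrite -ler_pdivrMr ?price_gt0 // /K (bigD1 (i, a)) //= addrCA lerDl.
  by rewrite addr_ge0 // sumr_ge0.
exists (fun i => K ^+ (T.+1 - level i)) => [i|[i a]]; first exact: exprn_ge0.
rewrite /budget_coef /wealth_coef /=.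
set l := level i; have lT : (l <= T)%N by apply: level_le.
under [leRHS]eq_bigr do rewrite mulrBr mulrBl.
rewrite sumrB (bigD1 i) //= eqxx mulr1 [X in _ + X - _]big1 => [|i' /negPf]; last first.
  by rewrite eq_sym => ->; rewrite mulr0 mul0r.
rewrite addr0 lerBrDr.
(* Children of [i] carry the multiplier K^(T-l), one factor K less than [i]. The exponent T+1-l
   leaves that factor even at level T, where it pays for terminal wealth. *)
apply: (@le_trans _ _ (K ^+ (T - l) * s a)); last first.
  by rewrite subSn // exprSr mulrCA ler_wpM2l ?exprn_ge0 // mulrC.
rewrite addrC mulrDr; apply: lerD.
  rewrite mulr_sumr; apply: ler_sum => i' _.
  case: (boolP (_ && _)) => [/andP[ir /eqP Ei]|_].
    by rewrite (level_parent ir) -Ei subSS mulr1 mulrC.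
  by rewrite mulr0 mul0r mulr_ge0 ?exprn_ge0.
apply: (@le_trans _ _ (\sum_j p j * tprice M j a)).
  by rewrite [leRHS](bigID (fun j => tparent tr j == i)) /= lerDl sumr_ge0.
by rewrite ler_peMl ?sumr_ge0 // exprn_ege1.
Qed.

End ScenarioLP.

(** * Absence of a duality gap *)

Theorem theorem4p21 (R : realType) (T k m : nat) (hT : (1 <= T)%N) (hk : (1 <= k)%N)
    (tr : scenario_tree T m) (M : market R k tr)
    (G : {ffun tr -> R}) (hG0 : 0 < G (root_node tr))
    (hG : forall i : tr, i != root_node tr -> G i < 0)
    (hfeas : feasible M G 0 !=set0)
    (p : {ffun 'I_m -> R}) (hp : simplex p)
    (hpcrit : forall j : 'I_m, j \notin original tr -> p j = 0)
    (hNA : arbitrage_free M p)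
    (theta : R) (htheta : 0 <= theta) :
  exists2 X : strategy R k tr,
    (forall X' : strategy R k tr, (phi M G p X <= phi M G p X')%E)
  & ereal_sup [set psi3 M G p theta yz.1 yz.2
              | yz in [set: {ffun 'I_m -> R} * {ffun tr -> R}]]
    = phi M G p X.
Proof.
have p0 j : 0 <= p j by case: hp => + _; apply.
have [X0 /feasibleE[X0_ge0 HX0]] := hfeas.
have [y0 y0_ge0 Hy0] := dual_feasible M p0.
have {}HX0 i : \sum_e budget_coef M i e * X0 e.1 e.2 <= G i.
  by have := HX0 i; rewrite ffunE addr0.
have [x [y [x_ge0 Hx y_ge0 Hy xy]]] :=
  lp_strong_duality X0_ge0 HX0 y0_ge0 Hy0.
pose X : strategy R k tr := [ffun i => [ffun a => x (i, a)]].
have XE e : X e.1 e.2 = x e by rewrite !ffunE -surjective_pairing.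
have FX : feasible M G 0 X.
  apply/feasibleE; split=> [e|i]; first by rewrite XE.
  by rewrite ffunE addr0; under eq_bigr do rewrite XE.
have phiX : phi M G p X = (- \sum_i G i * y i)%:E.
  rewrite /phi /cvx_indicator mem_set // adde0 -wealth_coefE -xy.
  by congr (- _)%:E; apply: eq_bigr => e _; rewrite XE.
(* The multipliers [y] stay dual feasible when the claim is perturbed, so they bound the wealth by
   an affine function of [v]; its slope is why [- y] serves as [z] below. *)
have weak v X' : feasible M G v X' ->
    \sum_j p j * terminal_wealth M X' j <= \sum_i (G i + v i) * y i.
  by case/feasibleE => X'0 HX'; rewrite -wealth_coefE; apply: lp_weak_duality HX' _ _.
exists X => [X'|].
  rewrite phiX /phi /cvx_indicator; case: ifPn => [/set_mem /weak H|_].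
    rewrite adde0 lee_fin lerN2 (le_trans H) // ler_sum // => i _.
    by rewrite ffunE addr0.
  by rewrite addey // leey.
apply/eqP; rewrite eq_le; apply/andP; split.
  (* At (0, 0, X) both pairings vanish and [f3] equals [phi], which bounds every dual value. *)
  apply: ge_ereal_sup => _ [[y1 z1] _ <-].
  apply: ereal_inf_lbound; exists (0, 0, X) => //=.
  have dot0 (I : finType) (h : {ffun I -> R}) : dot h 0 = 0.
    by rewrite /dot big1 // => i _; rewrite ffunE mulr0.
  rewrite !dot0 !oppr0 !adde0 /f3 /phi /cvx_indicator addr0.
  rewrite [X in (_ * X)%:E]big1 => [|j _]; last by rewrite ffunE expr0n.
  rewrite mulr0 adde0 [in X in _ + X + _]mem_set; last by move=> j; apply: p0.
  rewrite [in X in _ + _ + X]mem_set; last by move=> j; rewrite ffunE.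
  rewrite !adde0; congr (_%:E + _)%E; congr (- _).
  by apply: eq_bigr => j _; rewrite ffunE addr0.
(* At [y = 0] the optimal [u] is [0], because terminal wealth is nonnegative
   on nonnegative strategies. *)
apply: (@le_trans _ _ (psi3 M G p theta 0 [ffun i => - y i])); last first.
  by apply: ereal_sup_ubound; exists (0, [ffun i => - y i]).
rewrite phiX; apply: le_ereal_inf_tmp => _ [[[u v] X'] _ <-] /=.
rewrite /f3 /cvx_indicator.
(* Outside any of the three indicator sets the value is +oo and the bound is trivial. *)
case: ifPn => [/set_mem FX'|_]; last by do 2 case: ifP => _; rewrite ?leey.
case: ifPn => [_|_]; last by case: ifP => _; rewrite ?leey.
case: ifPn => [/set_mem u0|_]; last by rewrite leey.
rewrite !adde0 -!EFinD lee_fin.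
have -> : dot 0 u = 0 by rewrite /dot big1 // => j _; rewrite ffunE mul0r.
have -> : dot [ffun i => - y i] v = - \sum_i v i * y i.
  by rewrite /dot -sumrN; apply: eq_bigr => i _; rewrite ffunE mulNr mulrC.
have W0 : \sum_j u j * terminal_wealth M X' j <= 0.
  apply: sumr_le0 => j _; apply: mulr_le0_ge0; first exact: u0.
  by apply: terminal_wealth_ge0; case: FX'.
have U0 : 0 <= 2^-1 * theta * \sum_j u j ^+ 2.
  by rewrite !mulr_ge0 ?invr_ge0 // sumr_ge0 // => j _; apply: sqr_ge0.
(* The [v] terms cancel, while the [u] terms only raise the value by [W0] and [U0]. *)
have := weak _ _ FX'.
under [leRHS]eq_bigr do rewrite mulrDl; rewrite big_split /=.
rewrite (_ : \sum_j (p j + u j) * _ = \sum_j p j * terminal_wealth M X' j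
  + \sum_j u j * terminal_wealth M X' j).
  lra.
by rewrite -big_split; apply: eq_bigr => j _; rewrite mulrDl.
Qed.
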